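(* Let $\mathcal A\subseteq\mathbb N=\{0,1,2,\dots\}$ be a finite or infinite set with $0\in\mathcal A$. For $n\ge 0$ let $f_{\mathcal A,2}(n)$ be the number of ways to write $n=\sum_{k\ge 0}\epsilon_k 2^k$ with all $\epsilon_k\in\mathcal A$ (only finitely many $\epsilon_k$ nonzero). Let $\phi_{\mathcal A}(x)=\sum_{a\in\mathcal A}x^a$ and $F_{\mathcal A,2}(x)=\sum_{n\ge0}f_{\mathcal A,2}(n)x^n$. Then, as elements of $\mathbb F_2[[x]]$ (coefficients reduced modulo $2$), $$F_{\mathcal A,2}(x)\,\phi_{\mathcal A}(x)=1.$$
   Context: Representations are counted as sequences $(\epsilon_k)_{k\ge0}$ of elements of $\mathcal A$ with finitely many nonzero terms; $f_{\mathcal A,2}(n)$ is finite since each $\epsilon_k\le n$. *)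

(* Defs.v *)
From HB Require Import structures.
From mathcomp Require Import all_boot all_algebra finmap.
From mathcomp Require Import all_classical.

Set Implicit Arguments.
Unset Strict Implicit.
Unset Printing Implicit Defensive.
Import GRing.Theory.
Local Open Scope classical_set_scope.
Local Open Scope ring_scope.

(* The record wrapper keeps the Cauchy product apart from the pointwise
   operations that the classical library puts on [nat -> R]. *)
Record fps (R : Type) := Fps { fps_coef : nat -> R }.

Notation "{ 'fps' R }" := (fps R) (at level 0, format "{ 'fps'  R }").
Notation "f ``_ n" := (fps_coef f n)
  (at level 3, n at level 2, left associativity, format "f ``_ n").

HB.instance Definition _ (R : Type) := gen_eqMixin {fps R}.
HB.instance Definition _ (R : Type) := gen_choiceMixin {fps R}.

Lemma fpsP (R : Type) (f g : {fps R}) : (forall n, f``_n = g``_n) <-> f = g.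
Proof.
split=> [|-> //]; case: f g => [f] [g] /= fg.
by congr Fps; apply/funext.
Qed.

Section FpsRing.
Variable R : comNzRingType.
Implicit Types f g h : {fps R}.

Definition fps_zero : {fps R} := Fps (fun=> 0).
Definition fps_opp f : {fps R} := Fps (fun n => - f``_n).
Definition fps_add f g : {fps R} := Fps (fun n => f``_n + g``_n).
Definition fps_one : {fps R} := Fps (fun n => (n == 0%N)%:R).
Definition fps_mul f g : {fps R} :=
  Fps (fun n => \sum_(i < n.+1) f``_i * g``_(n - i)).

Fact fps_addA : associative fps_add.
Proof. by move=> f g h; apply/fpsP => n; apply: addrA. Qed.
Fact fps_addC : commutative fps_add.
Proof. by move=> f g; apply/fpsP => n; apply: addrC. Qed.
Fact fps_add0 : left_id fps_zero fps_add.
Proof. by move=> f; apply/fpsP => n; apply: add0r. Qed.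
Fact fps_addN : left_inverse fps_zero fps_opp fps_add.
Proof. by move=> f; apply/fpsP => n; apply: addNr. Qed.

HB.instance Definition _ := GRing.isZmodule.Build {fps R}
  fps_addA fps_addC fps_add0 fps_addN.

Definition fps_trunc N f : {poly R} := \poly_(i < N) f``_i.

Lemma fps_truncM N f g n : (n < N)%N ->
  (fps_mul f g)``_n = (fps_trunc N f * fps_trunc N g)`_n.
Proof.
move=> nN; rewrite coefM; apply: eq_bigr => i _; rewrite !coef_poly.
by rewrite (leq_ltn_trans (leq_ord i) nN) (leq_ltn_trans (leq_subr i n) nN).
Qed.

Fact fps_mulC : commutative fps_mul.
Proof.
by move=> f g; apply/fpsP => n; rewrite !(@fps_truncM n.+1)// mulrC.
Qed.

Fact fps_mulA : associative fps_mul.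
Proof.
move=> f g h; apply/fpsP => n.
transitivity ((fps_trunc n.+1 f * fps_trunc n.+1 g * fps_trunc n.+1 h)`_n).
  rewrite -mulrA coefM; apply: eq_bigr => i _.
  by rewrite coef_poly ltn_ord (@fps_truncM n.+1) // ltnS leq_subr.
rewrite coefM; apply: eq_bigr => i _.
by rewrite coef_poly ltnS leq_subr (@fps_truncM n.+1).
Qed.

Fact fps_mul1 : left_id fps_one fps_mul.
Proof.
move=> f; apply/fpsP => n /=; rewrite big_ord_recl/= subn0 mul1r big1 ?addr0//.
by move=> i _; rewrite mul0r.
Qed.

Fact fps_mulDl : left_distributive fps_mul fps_add.
Proof.
move=> f g h; apply/fpsP => n /=; rewrite -big_split/=.
by apply: eq_bigr => i _; rewrite mulrDl.
Qed.

Fact fps_one_neq0 : fps_one != fps_zero.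
Proof.
by apply/eqP => /fpsP/(_ 0%N)/= /eqP; rewrite oner_eq0.
Qed.

HB.instance Definition _ := GRing.Zmodule_isComNzRing.Build {fps R}
  fps_mulA fps_mulC fps_mul1 fps_mulDl fps_one_neq0.

End FpsRing.

Section Representations.
Variable A : set nat.

Definition reprs (n : nat) : set {fsfun nat -> nat with 0%N} :=
  [set e : {fsfun nat -> nat with 0%N} | (forall k, A (e k)) /\
           (\sum_(k <- finsupp e) e k * 2 ^ k = n)%N].

Lemma finite_reprs n : finite_set (reprs n).
Proof.
pose dec (u : {ffun 'I_n.+1 -> 'I_n.+1}) : {fsfun nat -> nat with 0%N} :=
  [fsfun k in seq_fset tt (iota 0 n.+1) => val (u (inord k)) | 0%N].
apply: (@sub_finite_set _ _ (dec @` setT)); last first.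
  exact/finite_image/finite_finset.
move=> e [_ en].
have le_n k : (e k * 2 ^ k <= n)%N.
  case: finsuppP => [//|ke]; rewrite -en (big_fsetD1 k)//=; exact: leq_addr.
exists [ffun i : 'I_n.+1 => inord (e i)] => //.
apply/fsfunP => k; rewrite fsfunE seq_fsetE mem_iota/= add0n.
case: ltnP => [kn|nk].
  rewrite ffunE !inordK// ?ltnS; apply: leq_trans (le_n k).
  by rewrite leq_pmulr// expn_gt0.
have [//|e_gt0] := posnP (e k).
have lt_n : (n < e k * 2 ^ k)%N.
  apply: leq_trans nk (leq_trans _ (leq_pmull _ e_gt0)).
  exact/ltnW/ltn_expl.
by have := le_n k; rewrite leqNgt lt_n.
Qed.

(* [fset_set] is meaningful here thanks to [finite_reprs]. *)
Definition repr_count (n : nat) : nat := #|` fset_set (reprs n)|.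

Definition phi_series (R : pzSemiRingType) : {fps R} :=
  Fps (fun n => (n \in A)%:R).

Definition repr_series (R : pzSemiRingType) : {fps R} :=
  Fps (fun n => (repr_count n)%:R).

End Representations.

(* Main.v *)
(** Splitting off the digit [e 0] of a representation gives
    [F(x) = phi(x) F(x^2)]; over [F_2], [F(x^2) = F(x)^2], so
    [F = phi F^2], and [F] can be cancelled since its constant term is [1]. *)

Require Import Defs.
From mathcomp Require Import all_boot all_algebra.
From mathcomp Require Import finmap.
From mathcomp Require Import all_classical.
Local Open Scope ring_scope.
Import GRing.Theory.
Local Open Scope fset_scope.

Lemma fps_mul_eq0r (R : comNzRingType) (f g : {fps R}) :
  f``_0 = 1 -> f * g = 0 -> g = 0.
Proof.
move=> f0 fg0; apply/fpsP => n.
elim/ltn_ind: n => n IHn.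
have /fpsP/(_ n) /= := fg0.
rewrite big_ord_recl /= subn0 f0 mul1r big1 ?addr0 // => i _.
by rewrite IHn ?mulr0 //= /bump /= add1n ltn_subrL (leq_ltn_trans _ (ltn_ord i)).
Qed.

(** In characteristic 2 squaring is additive, and it fixes both constants 0 and 1, so the identity
    propagates through the Horner form [p * 'X + c]. *)
Lemma sqr_poly_F2 (p : {poly 'F_2}) : p ^+ 2 = p \Po 'X^2.
Proof.
have ch : 2%N \in [pchar {poly 'F_2}] by rewrite pchar_poly; apply: pchar_Fp.
elim/poly_ind: p => [|p c IHp]; first by rewrite comp_poly0 expr0n.
have c2 : c ^+ 2 = c by apply/val_inj; case: c => [[|[|[]]]].
rewrite comp_polyD comp_polyM comp_polyX comp_polyC -IHp.
rewrite -(pFrobenius_autE ch) pFrobenius_autD_comm; last exact: mulrC.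
by rewrite !pFrobenius_autE exprMn -polyC_exp c2.
Qed.

(** The coefficient of index [n] in a product only sees the factors truncated below degree [n.+1],
    so the polynomial identity carries over to series. *)
Lemma coef_sqr_fps_F2 (f : {fps 'F_2}) n :
  (f ^+ 2)``_n = if (2 %| n)%N then f``_(n %/ 2) else 0.
Proof.
rewrite (@fps_truncM _ n.+1) // -expr2 sqr_poly_F2 coef_comp_poly_Xn //.
by rewrite coef_poly ltnS leq_div.
Qed.

Definition digit_sum (e : {fsfun nat -> nat with 0%N}) : nat :=
  (\sum_(k <- finsupp e) e k * 2 ^ k)%N.

Definition cons_digit (a : nat) (e : {fsfun nat -> nat with 0%N}) :
    {fsfun nat -> nat with 0%N} :=
  [fsfun k in 0%N |` [fset k.+1 | k in finsupp e] =>
     if k is k'.+1 then e k' else a | 0%N].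

(** Since [0.-1 = 0], index 0 may enter the domain although [e 1] is 0; this is harmless, the value
    there still being [e 1]. *)
Definition behead_digits (e : {fsfun nat -> nat with 0%N}) :
    {fsfun nat -> nat with 0%N} :=
  [fsfun k in [fset k.-1 | k in finsupp e] => e k.+1 | 0%N].

Lemma cons_digitE a e k :
  cons_digit a e k = if k is k'.+1 then e k' else a.
Proof.
rewrite fsfunE; case: k => [|k]; rewrite in_fset1U //=.
rewrite mem_imfset /=; last exact: succn_inj.
by case: finsuppP.
Qed.

Lemma behead_digitsE e k : behead_digits e k = e k.+1.
Proof.
rewrite fsfunE; case: ifPn => // /imfsetP nk.
by case: finsuppP => // ke; case: nk; exists k.+1.
Qed.

Lemma cons_digitK (e : {fsfun nat -> nat with 0%N}) :
  cons_digit (e 0%N) (behead_digits e) = e.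
Proof.
by apply/fsfunP => -[|k]; rewrite cons_digitE // behead_digitsE.
Qed.

Lemma cons_digit_inj a : injective (cons_digit a).
Proof.
move=> e e' /fsfunP ee'; apply/fsfunP => k.
by have := ee' k.+1; rewrite !cons_digitE.
Qed.

Lemma digit_sum_cons a e :
  digit_sum (cons_digit a e) = (a + 2 * digit_sum e)%N.
Proof.
(* For [a = 0] the support misses index 0, so the sum is first extended to the whole domain of the
   definition; the added terms are zero. *)
rewrite /digit_sum (big_fset_incl _ (finsupp_sub _ _ _)) /=; last first.
  by move=> k _; rewrite memNfinsupp => /eqP ->.
rewrite big_fsetU1 /=; last by apply/imfsetP => -[].
rewrite cons_digitE muln1 big_imfset /=; last by move=> ? ? _ _; apply: succn_inj.
rewrite big_distrr /=; congr addn; apply: eq_bigr => k _.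
by rewrite cons_digitE expnS mulnCA.
Qed.

Lemma cons_digit_reprs (A : set nat) a e n :
  reprs A n (cons_digit a e) <->
  A a /\ (exists2 m, reprs A m e & n = (a + 2 * m)%N).
Proof.
split=> [[Ae en]|[Aa [m [Ae em ->]]]]; last first.
  split; first by case=> [|k]; rewrite cons_digitE.
  by rewrite -em; apply: digit_sum_cons.
split; first by have := Ae 0%N; rewrite cons_digitE.
exists (digit_sum e); last by rewrite -digit_sum_cons.
by split=> // k; have := Ae k.+1; rewrite cons_digitE.
Qed.

(** When [a] is in [A] and [n - a] is even, [cons_digit a] is a bijection from the representations
    of [(n - a) / 2] onto those of [n] with lowest digit [a]; otherwise there are none of the
    latter. The bound on [a] keeps the subtraction from truncating. *)
Lemma card_reprs_digit0 (A : set nat) n (a : nat) : (a <= n)%N ->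
  #|` [fset e in fset_set (reprs A n) | e 0%N == a]| =
  ((a \in A) * (if (2 %| n - a)%N then repr_count A ((n - a) %/ 2) else 0))%N.
Proof.
move=> an.
have memS m e : (e \in fset_set (reprs A m)) = (e \in reprs A m).
  by rewrite in_fset_set //; apply: finite_reprs.
have [|nAa] := boolP (a \in A); last first.
  rewrite mul0n; apply/eqP; rewrite cardfs_eq0; apply/eqP/fsetP => e.
  rewrite !inE /= memS; apply/negP => /andP[/set_mem[Ae _] /eqP ea].
  by case/negP: nAa; apply/mem_set; rewrite -ea.
move=> /set_mem Aa; rewrite mul1n.
case: ifPn => [/divnK|] n_a.
  transitivity #|` [fset cons_digit a e
      | e in fset_set (reprs A ((n - a) %/ 2))]|; last first.
    by rewrite card_imfset //; apply: cons_digit_inj.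
  congr #|` _|; apply/fsetP => e; rewrite !inE /= memS.
  apply/andP/imfsetP => /= [[/set_mem eA /eqP ea]|[e' + ->]].
    exists (behead_digits e); last by rewrite -ea cons_digitK.
    move: eA; rewrite -{1}[e]cons_digitK => /cons_digit_reprs[_ [m em]].
    by rewrite ea => ->; rewrite memS addKn mulKn //; apply/mem_set.
  rewrite memS => /set_mem eA; rewrite cons_digitE; split=> //.
  apply/mem_set/cons_digit_reprs; split=> //.
  by exists ((n - a) %/ 2)%N => //; rewrite mulnC n_a subnKC.
apply/eqP; rewrite cardfs_eq0; apply/eqP/fsetP => e.
rewrite !inE /= memS; apply/negP => /andP[/set_mem eA /eqP ea].
case/negP: n_a; move: eA; rewrite -{1}[e]cons_digitK ea.
by move=> /cons_digit_reprs[_ [m _ ->]]; rewrite addKn dvdn_mulr.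
Qed.

(** The representations are partitioned by their lowest digit, which is at most [n] because
    [n = e 0 + 2 * m]. *)
Lemma repr_count_rec (A : set nat) n :
  repr_count A n = (\sum_(a < n.+1) (val a \in A) *
    (if 2 %| n - a then repr_count A ((n - a) %/ 2) else 0))%N.
Proof.
transitivity (\sum_(a < n.+1)
    #|` [fset e in fset_set (reprs A n) | e 0%N == a]|)%N; last first.
  by apply: eq_bigr => a _; rewrite card_reprs_digit0 // -ltnS.
have le_n e : e \in fset_set (reprs A n) -> (e 0%N < n.+1)%N.
  rewrite in_fset_set; last exact: finite_reprs.
  rewrite -[in e \in _](cons_digitK e) => /set_mem /cons_digit_reprs[_ [m _ ->]].
  by rewrite ltnS leq_addr.
(* Double counting: each [e] contributes 1, from the single index [a] equal to [e 0]; then the two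
   sums are exchanged. *)
transitivity (\sum_(e <- fset_set (reprs A n)) \sum_(a < n.+1) (e 0%N == a))%N.
  rewrite /repr_count card_fset_sum1 big_seq [RHS]big_seq.
  apply: eq_bigr => e /le_n e0n; rewrite (bigD1 (Ordinal e0n)) //= eqxx big1 //.
  by move=> a; rewrite eq_sym -val_eqE /= => /negPf ->.
rewrite exchange_big /=; apply: eq_bigr => a _.
by rewrite card_fset_sum1 big_fset /= [RHS]big_mkcond.
Qed.

Lemma repr_count0 (A : set nat) : A 0%N -> repr_count A 0 = 1%N.
Proof.
move=> A0; rewrite /repr_count.
suff -> : fset_set (reprs A 0) = [fset [fsfun]] by rewrite cardfs1.
apply/fsetP => e; rewrite in_fset_set; last exact: finite_reprs.
rewrite in_fset1; apply/idP/eqP => [/set_mem[_ /eqP e0]|->]; last first.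
  by apply/mem_set; split=> [k|]; rewrite ?fsfun0E // finsupp0 big_seq_fset0.
apply/fsfunP => k; rewrite fsfun0E; case: finsuppP => // ke.
move: e0; rewrite (big_fsetD1 k) //= addn_eq0 muln_eq0 expn_eq0 orbF.
by case/andP => /eqP.
Qed.

Theorem theorem1p1 (A : set nat) (hA : A 0%N) :
  repr_series A 'F_2 * phi_series A 'F_2 = 1.
Proof.
set F := repr_series A _; set phi := phi_series A _.
have FE : F = phi * F ^+ 2.
  apply/fpsP => n.
  transitivity (\sum_(a < n.+1) phi``_a * (F ^+ 2)``_(n - a)) => //.
  (* Modulo 2, the conditional factor of the recurrence is exactly the coefficient of index [n - a]
     in [F ^+ 2]. *)
  rewrite [LHS]/= repr_count_rec natr_sum; apply: eq_bigr => a _.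
  by rewrite natrM coef_sqr_fps_F2; case: ifP.
(* Cancelling [F] leaves [F * (F * phi - 1) = phi * F ^+ 2 - F = 0] to check. *)
apply/eqP; rewrite -subr_eq0; apply/eqP; apply: (@fps_mul_eq0r _ F).
  by rewrite /= repr_count0.
by rewrite mulrBr mulr1 [F * phi]mulrC mulrCA -expr2 -FE subrr.
Qed.
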